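(* Let $\lambda\in\mathbb F$ and let $\mu=0$ or $\mu=1$. Then the $\mathrm{ad}(A_\omega^\delta)$-module $(V,\psi_{\lambda\mu})$ is the induced module associated with the 3-Lie algebra $A_\omega^\delta$-module $T_{\lambda\mu}=(V,\rho_{\lambda\mu})$.
   Context: $\mathbb F$ is a field of characteristic zero (so $\mathbb Z\subset\mathbb F$); all vector spaces and algebras are over $\mathbb F$. A 3-Lie algebra is a vector space $B$ with a linear map $[\,,\,,\,]:B\wedge B\wedge B\to B$ satisfying $[x_1,x_2,[x_3,x_4,x_5]]=[[x_1,x_2,x_3],x_4,x_5]+[x_3,[x_1,x_2,x_4],x_5]+[x_3,x_4,[x_1,x_2,x_5]]$. For $x,y\in B$, $\mathrm{ad}(x,y)(z)=[x,y,z]$; the inner derivation algebra $\mathrm{ad}(B)$ is the Lie algebra (under the commutator) of all linear combinations of the maps $\mathrm{ad}(x,y)$. A module of a 3-Lie algebra $B$ is a pair $(W,\rho)$, with $W$ a vector space and $\rho:B\wedge B\to gl(W)$ linear, such that for all $x_i\in B$: $[\rho(x_1,x_2),\rho(x_3,x_4)]=\rho([x_1,x_2,x_3],x_4)+\rho(x_3,[x_1,x_2,x_4])$ and $\rho([x_1,x_2,x_3],x_4)=\rho(x_1,x_2)\rho(x_3,x_4)+\rho(x_2,x_3)\rho(x_1,x_4)+\rho(x_3,x_1)\rho(x_2,x_4)$. Induced modules: for a $B$-module $(W,\rho)$, let $L_\rho(W)$ be the linear span of $\{\rho(x,y)\mid x,y\in B\}$, a Lie subalgebra of $gl(W)$.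 If the center $Z(L_\rho(W))$ is $0$, there is a well-defined linear map $\bar\rho:\mathrm{ad}(B)\to gl(W)$ with $\bar\rho(\mathrm{ad}(x,y))=\rho(x,y)$ for all $x,y\in B$, and $(W,\bar\rho)$ is an $\mathrm{ad}(B)$-module, called the induced module associated with the $B$-module $(W,\rho)$. $A_\omega^\delta$ is the (simple) 3-Lie algebra with basis $\{L_r,M_r\mid r\in\mathbb Z\}$ and (skew-symmetric) bracket determined by $[L_r,L_s,M_t]=(s-r)L_{r+s-t}$, $[L_r,M_s,M_t]=(t-s)M_{s+t-r}$ for $r,s,t\in\mathbb Z$, all other brackets of basis elements (i.e. $[L_r,L_s,L_t]$ and $[M_r,M_s,M_t]$) being zero. It is known that $\mathrm{ad}(A_\omega^\delta)$ has a basis $\{p_r,q_r,x_r,z_r\mid r\in\mathbb Z\}$, where for $r\neq0$: $p_r=\frac12(\mathrm{ad}(L_0,M_{-r})+\mathrm{ad}(L_r,M_0))$, $q_r=\frac1r(\mathrm{ad}(L_0,M_{-r})-\mathrm{ad}(L_r,M_0))$, $x_r=\frac1r\mathrm{ad}(L_r,L_0)$, $z_r=\frac1{-r}\mathrm{ad}(M_{-r},M_0)$; and $p_0=\mathrm{ad}(L_0,M_0)$, $q_0=\mathrm{ad}(L_0,M_0)-\mathrm{ad}(L_1,M_1)$, $x_0=\frac12\mathrm{ad}(L_1,L_{-1})$, $z_0=\frac12\mathrm{ad}(M_1,M_{-1})$. The Lie brackets are: $[p_r,p_s]=(r-s)p_{r+s}$, $[p_r,q_s]=-sq_{r+s}$,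 $[p_r,x_s]=-sx_{r+s}$, $[p_r,z_s]=-sz_{r+s}$, $[q_r,x_s]=-2x_{r+s}$, $[q_r,z_s]=2z_{r+s}$, $[z_r,x_s]=q_{r+s}$, the others being zero. $V=\sum_{\alpha\in\mathbb F}\mathbb F v_\alpha$ is the vector space with basis $\{v_\alpha\mid\alpha\in\mathbb F\}$. For $\lambda,\mu\in\mathbb F$: - $\rho_{\lambda\mu}:A_\omega^\delta\wedge A_\omega^\delta\to gl(V)$ is the linear map with $\rho_{\lambda\mu}(L_r,M_s)v_\alpha=(\lambda+\alpha+(s-r)\mu)v_{\alpha+s-r}$, $\rho_{\lambda\mu}(L_r,L_s)v_\alpha=0$, $\rho_{\lambda\mu}(M_r,M_s)v_\alpha=0$ ($r,s\in\mathbb Z$, $\alpha\in\mathbb F$); $T_{\lambda\mu}=(V,\rho_{\lambda\mu})$ is an $A_\omega^\delta$-module when $\mu\in\{0,1\}$; - $\psi_{\lambda\mu}:\mathrm{ad}(A_\omega^\delta)\to gl(V)$ is the linear map with $\psi_{\lambda\mu}(p_r)v_\alpha=(\lambda+\alpha-r\mu)v_{\alpha-r}$, $\psi_{\lambda\mu}(q_r)v_\alpha=\psi_{\lambda\mu}(x_r)v_\alpha=\psi_{\lambda\mu}(z_r)v_\alpha=0$ ($r\in\mathbb Z$, $\alpha\in\mathbb F$); it makes $V$ an $\mathrm{ad}(A_\omega^\delta)$-module. *)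

(* Defs.v *)
From HB Require Import structures.
From mathcomp Require Import all_boot all_order all_algebra.
From mathcomp Require Import boolp finmap.
From mathcomp Require Import ring.
From mathcomp.multinomials Require Import monalg.

Set Implicit Arguments.
Unset Strict Implicit.
Unset Printing Implicit Defensive.

Import GRing.Theory.
Local Open Scope ring_scope.

Section HomSpace.
Context (F : fieldType) (U W : lmodType F).
Implicit Types f g h : {linear U -> W}.

Lemma hom_ext f g : (forall x, f x = g x) -> f = g.
Proof.
case: f g => [f cf] [g cg] /= /funext fg; subst g; congr GRing.Linear.Pack.
case: cf cg => [[c1] [c2]] [[d1] [d2]].
by rewrite (Prop_irrelevance c1 d1) (Prop_irrelevance c2 d2).
Qed.

HB.instance Definition _ := gen_eqMixin {linear U -> W}.
HB.instance Definition _ := gen_choiceMixin {linear U -> W}.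

Definition hom_zero : {linear U -> W} := \0.
Definition hom_opp f : {linear U -> W} := \- f.
Definition hom_add f g : {linear U -> W} := f \+ g.
Definition hom_scale (a : F) f : {linear U -> W} := a \*: f.

Fact hom_addA : associative hom_add.
Proof. by move=> f g h; apply: hom_ext => x /=; rewrite addrA. Qed.
Fact hom_addC : commutative hom_add.
Proof. by move=> f g; apply: hom_ext => x /=; rewrite addrC. Qed.
Fact hom_add0 : left_id hom_zero hom_add.
Proof. by move=> f; apply: hom_ext => x /=; rewrite add0r. Qed.
Fact hom_addN : left_inverse hom_zero hom_opp hom_add.
Proof. by move=> f; apply: hom_ext => x /=; rewrite addNr. Qed.

HB.instance Definition _ := GRing.isZmodule.Build {linear U -> W}
  hom_addA hom_addC hom_add0 hom_addN.

Fact hom_scaleA a b f : hom_scale a (hom_scale b f) = hom_scale (a * b) f.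
Proof. by apply: hom_ext => x /=; rewrite scalerA. Qed.
Fact hom_scale1 : left_id 1 hom_scale.
Proof. by move=> f; apply: hom_ext => x /=; rewrite scale1r. Qed.
Fact hom_scaleDr : right_distributive hom_scale +%R.
Proof. by move=> a f g; apply: hom_ext => x /=; rewrite scalerDr. Qed.
Fact hom_scaleDl f : {morph hom_scale^~ f : a b / a + b}.
Proof. by move=> a b; apply: hom_ext => x /=; rewrite scalerDl. Qed.

HB.instance Definition _ := GRing.Zmodule_isLmodule.Build F {linear U -> W}
  hom_scaleA hom_scale1 hom_scaleDr hom_scaleDl.

Lemma add_homE f g x : (f + g) x = f x + g x. Proof. by []. Qed.
Lemma opp_homE f x : (- f) x = - f x. Proof. by []. Qed.
Lemma scale_homE a f x : (a *: f) x = a *: f x. Proof. by []. Qed.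
Lemma zero_homE x : (0 : {linear U -> W}) x = 0. Proof. by []. Qed.
Lemma sum_homE I (r : seq I) (P : pred I) (E : I -> {linear U -> W}) x :
  (\sum_(i <- r | P i) E i) x = \sum_(i <- r | P i) E i x.
Proof.
elim/big_rec2: _ => [|i y1 y2 _ <-]; first by rewrite zero_homE.
by rewrite add_homE.
Qed.

End HomSpace.

Notation gl W := {linear W -> W}.

Section Commutator.
Context (F : fieldType) (W : lmodType F).
Implicit Types f g : gl W.

Definition gl_comm f g : gl W := (f \o g : gl W) - (g \o f : gl W).

Lemma gl_commE f g w : gl_comm f g w = f (g w) - g (f w).
Proof. by []. Qed.

Lemma gl_comm_suml I (r : seq I) (E : I -> gl W) g :
  gl_comm (\sum_(i <- r) E i) g = \sum_(i <- r) gl_comm (E i) g.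
Proof.
apply: hom_ext => w; rewrite sum_homE gl_commE !sum_homE linear_sum -sumrB.
by [].
Qed.

Lemma gl_commN f g : gl_comm f g = - gl_comm g f.
Proof. by apply: hom_ext => w; rewrite opp_homE !gl_commE opprB. Qed.

Lemma gl_commZl a f g : gl_comm (a *: f) g = a *: gl_comm f g.
Proof.
by apply: hom_ext => w; rewrite scale_homE !gl_commE !scale_homE linearZ scalerBr.
Qed.

End Commutator.

Section Span.
Context (F : fieldType) (U W : lmodType F) (b : U -> U -> W).

(* All finite linear combinations of the values b x y. *)
Definition span2 (w : W) : Prop :=
  exists s : seq (F * (U * U)), w = \sum_(t <- s) t.1 *: b t.2.1 t.2.2.

Lemma span2_0 : span2 0. Proof. by exists [::]; rewrite big_nil. Qed.
Lemma span2D v w : span2 v -> span2 w -> span2 (v + w).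
Proof. by move=> [s ->] [t ->]; exists (s ++ t); rewrite big_cat. Qed.
Lemma span2Z a w : span2 w -> span2 (a *: w).
Proof.
move=> [s ->]; exists [seq (a * t.1, t.2) | t <- s].
by rewrite big_map scaler_sumr; apply: eq_bigr => t _; rewrite scalerA.
Qed.
Lemma span2_gen x y : span2 (b x y).
Proof. by exists [:: (1, (x, y))]; rewrite big_seq1 scale1r. Qed.
Lemma span2_sum I (r : seq I) (E : I -> W) :
  (forall i, span2 (E i)) -> span2 (\sum_(i <- r) E i).
Proof.
by move=> sE; elim/big_rec: _ => [|i y _]; [exact: span2_0|exact: span2D].
Qed.

End Span.

(* With bilinearity built into the type, this is a linear map out of U /\ U. *)
Definition alternating (F : fieldType) (U W : lmodType F)
    (b : {linear U -> {linear U -> W}}) : Prop :=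
  forall x, b x x = 0.

HB.mixin Record Lmodule_isThreeLie (F : fieldType) B of GRing.Lmodule F B := {
  br3 : {linear B -> {linear B -> gl B}};
  br3_alt : alternating br3;
  br3_alt23 : forall x y : B, br3 x y y = 0;
  br3_jacobi : forall x1 x2 x3 x4 x5 : B,
    br3 x1 x2 (br3 x3 x4 x5) =
      br3 (br3 x1 x2 x3) x4 x5 + br3 x3 (br3 x1 x2 x4) x5
      + br3 x3 x4 (br3 x1 x2 x5) }.

#[short(type="threeLieType")]
HB.structure Definition ThreeLie (F : fieldType) :=
  { B of GRing.Lmodule F B & Lmodule_isThreeLie F B }.

Section Inner.
Context (F : fieldType) (B : threeLieType F).

(* ad(B) as an honest F-vector space: membership of an endomorphism in the span
   of the ad(x, y) is turned into a boolean classically, so that the subtype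
   inherits the vector space structure of gl(B). *)
Definition inner_pred : {pred gl B} :=
  fun f => `[< span2 (fun x y : B => br3 x y) f >].

Fact inner_submod : submod_closed inner_pred.
Proof.
split; first by apply/asboolP; exact: span2_0.
move=> a f g /asboolP sf /asboolP sg; apply/asboolP.
by apply: span2D => //; apply: span2Z.
Qed.

HB.instance Definition _ :=
  GRing.isSubmodClosed.Build F (gl B) inner_pred inner_submod.

Record inner := Inner { inner_val :> gl B; _ : inner_val \in inner_pred }.

HB.instance Definition _ := [isSub for inner_val].
HB.instance Definition _ := [Choice of inner by <:].
HB.instance Definition _ := [SubChoice_isSubLmodule of inner by <:].

Fact ad_subproof (x y : B) : (br3 x y : gl B) \in inner_pred.
Proof. exact/asboolP/(span2_gen (fun x y : B => br3 x y)). Qed.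

Definition ad (x y : B) : inner := Inner (ad_subproof x y).

Lemma gl_comm_ad (x1 x2 x3 x4 : B) :
  gl_comm (br3 x1 x2) (br3 x3 x4) =
    br3 (br3 x1 x2 x3) x4 + br3 x3 (br3 x1 x2 x4).
Proof.
by apply: hom_ext => x; rewrite gl_commE add_homE br3_jacobi addrK.
Qed.

Fact inner_comm_subproof (f g : inner) :
  gl_comm (inner_val f) (inner_val g) \in inner_pred.
Proof.
case: f g => [f pf] [g pg] /=.
have [s ->] := asboolW pf; have [t ->] := asboolW pg; apply/asboolP.
rewrite gl_comm_suml; apply: span2_sum => i; rewrite gl_commZl; apply: span2Z.
rewrite gl_commN -scaleN1r; apply: span2Z.
rewrite gl_comm_suml; apply: span2_sum => j; rewrite gl_commZl; apply: span2Z.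
by rewrite gl_comm_ad; apply: span2D; apply: span2_gen.
Qed.

Definition inner_comm (f g : inner) : inner := Inner (inner_comm_subproof f g).

End Inner.

Section Modules.
Context (F : fieldType) (B : threeLieType F) (W : lmodType F).
Implicit Types (rho : {linear B -> {linear B -> gl W}})
  (psi : {linear inner B -> gl W}).

Definition is_threeLie_module rho : Prop :=
  [/\ alternating rho,
      forall x1 x2 x3 x4 : B,
        gl_comm (rho x1 x2) (rho x3 x4) =
          rho (br3 x1 x2 x3) x4 + rho x3 (br3 x1 x2 x4)
    & forall x1 x2 x3 x4 : B,
        rho (br3 x1 x2 x3) x4 =
          (rho x1 x2 \o rho x3 x4 : gl W) + (rho x2 x3 \o rho x1 x4 : gl W)
          + (rho x3 x1 \o rho x2 x4 : gl W)].

Definition is_inner_module psi : Prop :=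
  forall f g : inner B, psi (inner_comm f g) = gl_comm (psi f) (psi g).

Definition Lrho rho : gl W -> Prop := span2 (fun x y => rho x y).

Definition center_trivial (L : gl W -> Prop) : Prop :=
  forall f, L f -> (forall g, L g -> gl_comm f g = 0) -> f = 0.

(* The last three clauses say that the center of L_rho(W) vanishes, so that the
   induced map exists, that psi is this induced map, and that it makes W a module
   over the Lie algebra ad(B); linearity of psi is part of its type. *)
Definition is_induced_module rho psi : Prop :=
  [/\ is_threeLie_module rho,
      center_trivial (Lrho rho),
      forall x y : B, psi (ad x y) = rho x y
    & is_inner_module psi].

End Modules.

Section FreeModule.
Context (F : fieldType) (K : choiceType).

(* The basis vector indexed by k. *)
Definition vec (k : K) : {malg F[K]} := mkmalgU k 1.

Lemma malg_vecE (x : {malg F[K]}) : x = \sum_(k <- msupp x) x@_k *: vec k.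
Proof.
rewrite [LHS]monalgE; apply: eq_bigr => k _; apply/malgP => l.
by rewrite mcoeffZ !mcoeffU mulrnAr mulr1.
Qed.

Lemma malg_lin_eq (W : lmodType F) (f g : {linear {malg F[K]} -> W}) :
  (forall k, f (vec k) = g (vec k)) -> f = g.
Proof.
move=> fg; apply: hom_ext => x; rewrite (malg_vecE x) !linear_sum.
by apply: eq_bigr => k _; rewrite !linearZ fg.
Qed.

Section Lext.
Context (W : lmodType F) (f : K -> W).

Definition lext_fun (x : {malg F[K]}) : W := \sum_(k <- msupp x) x@_k *: f k.

Lemma lext_funE (d : {fset K}) x : (msupp x `<=` d)%fset ->
  lext_fun x = \sum_(k <- d) x@_k *: f k.
Proof.
move=> le; rewrite /lext_fun [RHS](big_fsetID _ (mem (msupp x))) /=.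
rewrite [X in _ + X]big1_fset ?addr0.
  apply: eq_fbigl => k; rewrite !inE /=.
  case: (boolP (k \in msupp x)) => [kx|]; last by rewrite andbF.
  by rewrite (fsubsetP le).
by move=> k; rewrite !inE /= => /andP[_ /mcoeff_outdom ->]; rewrite scale0r.
Qed.

Fact lext_linear : linear lext_fun.
Proof.
move=> a x y; set d := (msupp x `|` msupp y)%fset.
rewrite !(@lext_funE d) ?fsubsetUl ?fsubsetUr //; last first.
  apply: fsubset_trans (msuppD_le _ _) _; apply: fsetSU; exact: msuppZ_le.
rewrite scaler_sumr -big_split; apply: eq_bigr => k _ /=.
by rewrite mcoeffD mcoeffZ scalerDl scalerA.
Qed.

HB.instance Definition _ :=
  GRing.isLinear.Build F {malg F[K]} W _ lext_fun lext_linear.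

(* The linear map with prescribed values on the basis. *)
Definition lext : {linear {malg F[K]} -> W} := lext_fun.

Lemma lextE k : lext (vec k) = f k.
Proof.
rewrite /lext /= (@lext_funE [fset k]%fset) ?msuppU_le //.
by rewrite big_seq_fset1 mcoeffUU scale1r.
Qed.

End Lext.

Lemma malg_bilinE (W : lmodType F)
    (b : {linear {malg F[K]} -> {linear {malg F[K]} -> W}}) x y :
  b x y = \sum_(k <- msupp x) \sum_(l <- msupp y)
            x@_k *: (y@_l *: b (vec k) (vec l)).
Proof.
rewrite [in LHS](malg_vecE x) (linear_sum b) sum_homE; apply: eq_bigr => k _.
rewrite linearZ scale_homE [in LHS](malg_vecE y) linear_sum scaler_sumr.
by apply: eq_bigr => l _; rewrite linearZ.
Qed.

Lemma malg_alternating (W : lmodType F)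
    (b : {linear {malg F[K]} -> {linear {malg F[K]} -> W}}) :
  (forall k, b (vec k) (vec k) = 0) ->
  (forall k l, b (vec k) (vec l) = - b (vec l) (vec k)) ->
  alternating b.
Proof.
move=> b0 bN.
have bN' x y : b x y = - b y x.
  rewrite !malg_bilinE exchange_big -sumrN; apply: eq_bigr => l _.
  rewrite -sumrN; apply: eq_bigr => k _.
  by rewrite bN !scalerN !scalerA mulrC.
move=> x; rewrite (malg_vecE x); elim: (msupp x : seq K) => [|k s IHs].
  by rewrite big_nil linear0.
rewrite big_cons (linearD b) add_homE !linearD IHs addr0 /=.
rewrite [b (\sum_(i <- s) _) _]bN' addrK.
by rewrite (linearZ_LR (b _)) (linearZ_LR b) scale_homE b0 !scaler0.
Qed.

Lemma malg_span_ind (P : {malg F[K]} -> Prop) : P 0 ->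
  (forall k, P (vec k)) ->
  (forall a x y, P x -> P y -> P (a *: x + y)) -> forall x, P x.
Proof.
move=> P0 Pv PD x; rewrite (malg_vecE x).
by elim/big_rec: _ => // k y _ Py; apply: PD.
Qed.

End FreeModule.

Section JacobiBasis.
Context (F : fieldType) (A : lmodType F) (L M : int -> A) (t : A -> A -> A -> A).

Let comb3 (N : int -> A) n0 n1 n2 n3 (a0 a1 a2 a3 : F) :
  n0 = n1 -> n0 = n2 -> n0 = n3 -> a0 = a1 + a2 + a3 ->
  a0 *: N n0 = a1 *: N n1 + a2 *: N n2 + a3 *: N n3.
Proof. by move=> <- <- <- ->; rewrite !scalerDl. Qed.

Let comb2 (N : int -> A) n0 n1 n2 (a0 a1 a2 : F) :
  n0 = n1 -> n0 = n2 -> a0 = a1 + a2 ->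
  a0 *: N n0 = a1 *: N n1 + a2 *: N n2.
Proof. by move=> <- <- ->; rewrite !scalerDl. Qed.

Let comb0 (N : int -> A) n1 n2 n3 (a1 a2 a3 : F) :
  n1 = n2 -> n1 = n3 -> a1 + a2 + a3 = 0 ->
  0 = a1 *: N n1 + a2 *: N n2 + a3 *: N n3.
Proof. by move=> <- <- a0; rewrite -!scalerDl a0 scale0r. Qed.

Let e (i : int + int) := match i with inl r => L r | inr r => M r end.

Context (A_ind : forall P : A -> Prop, (forall i, P (e i)) ->
  (forall a x y, P x -> P y -> P (a *: x + y)) -> forall x, P x).
Context (tl1 : forall a x y u v, t (a *: x + y) u v = a *: t x u v + t y u v).
Context (tl2 : forall a x y u v, t u (a *: x + y) v = a *: t u x v + t u y v).
Context (tl3 : forall a x y u v, t u v (a *: x + y) = a *: t u v x + t u v y).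
Context (tLLL : forall r s q, t (L r) (L s) (L q) = 0).
Context (tLLM : forall r s q,
  t (L r) (L s) (M q) = (s - r)%:~R *: L (r + s - q)).
Context (tLML : forall r s q,
  t (L r) (M q) (L s) = - ((s - r)%:~R *: L (r + s - q))).
Context (tMLL : forall r s q,
  t (M q) (L r) (L s) = (s - r)%:~R *: L (r + s - q)).
Context (tLMM : forall r s q,
  t (L r) (M s) (M q) = (q - s)%:~R *: M (s + q - r)).
Context (tMLM : forall r s q,
  t (M s) (L r) (M q) = - ((q - s)%:~R *: M (s + q - r))).
Context (tMML : forall r s q,
  t (M s) (M q) (L r) = (q - s)%:~R *: M (s + q - r)).
Context (tMMM : forall r s q, t (M r) (M s) (M q) = 0).

Let jac x1 x2 x3 x4 x5 := t x1 x2 (t x3 x4 x5) =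
  t (t x1 x2 x3) x4 x5 + t x3 (t x1 x2 x4) x5 + t x3 x4 (t x1 x2 x5).

Let jacobi_gen i1 i2 i3 i4 i5 : jac (e i1) (e i2) (e i3) (e i4) (e i5).
Proof.
have t01 u v : t 0 u v = 0.
  by have := tl1 (-1) 0 0 u v; rewrite scaler0 addr0 scaleN1r addNr.
have t02 u v : t u 0 v = 0.
  by have := tl2 (-1) 0 0 u v; rewrite scaler0 addr0 scaleN1r addNr.
have t03 u v : t u v 0 = 0.
  by have := tl3 (-1) 0 0 u v; rewrite scaler0 addr0 scaleN1r addNr.
have tZ1 a x u v : t (a *: x) u v = a *: t x u v.
  by have := tl1 a x 0 u v; rewrite t01 !addr0.
have tZ2 a x u v : t u (a *: x) v = a *: t u x v.
  by have := tl2 a x 0 u v; rewrite t02 !addr0.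
have tZ3 a x u v : t u v (a *: x) = a *: t u v x.
  by have := tl3 a x 0 u v; rewrite t03 !addr0.
rewrite /jac; move: i1 i2 i3 i4 i5.
have tE := (t01, t02, t03, tZ1, tZ2, tZ3, tLLL, tLLM, tLML, tMLL, tLMM, tMLM,
            tMML, tMMM).
case=> i1 [] i2 [] i3 [] i4 [] i5; rewrite /e !tE; try reflexivity.
all: rewrite -?scaleNr ?tE -?scaleNr ?scaler0 ?addr0 ?add0r ?scalerA.
all: try reflexivity.
all: first [apply: comb3 | apply: comb2 | apply: comb0]; ring.
Qed.

Lemma jacobi_free x1 x2 x3 x4 x5 : jac x1 x2 x3 x4 x5.
Proof.
have tl := (tl1, tl2, tl3).
have E a (p q r p' q' r' : A) : a *: (p + q + r) + (p' + q' + r') =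
    (a *: p + p') + (a *: q + q') + (a *: r + r').
  by rewrite !scalerDr addrACA (addrACA (a *: p)).
elim/A_ind: x1 x2 x3 x4 x5 => [i1|a x y Hx Hy] x2 x3 x4 x5; last first.
  by rewrite /jac !tl Hx Hy E.
elim/A_ind: x2 x3 x4 x5 => [i2|a x y Hx Hy] x3 x4 x5; last first.
  by rewrite /jac !tl Hx Hy E.
elim/A_ind: x3 x4 x5 => [i3|a x y Hx Hy] x4 x5; last first.
  by rewrite /jac !tl Hx Hy E.
elim/A_ind: x4 x5 => [i4|a x y Hx Hy] x5; last first.
  by rewrite /jac !tl Hx Hy E.
elim/A_ind: x5 => [i5|a x y Hx Hy]; last by rewrite /jac !tl Hx Hy E.
exact: jacobi_gen.
Qed.

End JacobiBasis.

Section Aomega.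
Context (F : fieldType).

(* The free vector space on the symbols L_r (inl r) and M_r (inr r). *)
Definition Aomega := {malg F[(int + int)%type]}.
HB.instance Definition _ := GRing.Lmodule.on Aomega.

Definition genL (r : int) : Aomega := vec F (inl r : int + int).
Definition genM (r : int) : Aomega := vec F (inr r : int + int).

Definition brLLM (r s t : int) : Aomega := (s - r)%:~R *: genL (r + s - t).
Definition brLMM (r s t : int) : Aomega := (t - s)%:~R *: genM (s + t - r).

(* The other orderings of the arguments get the sign of the permutation. *)
Definition br_basis (i j k : int + int) : Aomega :=
  match i, j, k with
  | inl r, inl s, inr t => brLLM r s t
  | inl r, inr t, inl s => - brLLM r s t
  | inr t, inl r, inl s => brLLM r s t
  | inl r, inr s, inr t => brLMM r s t
  | inr s, inl r, inr t => - brLMM r s t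
  | inr s, inr t, inl r => brLMM r s t
  | inl _, inl _, inl _ | inr _, inr _, inr _ => 0
  end.

Definition Aomega_br : {linear Aomega -> {linear Aomega -> gl Aomega}} :=
  lext (fun i => lext (fun j => lext (br_basis i j))).

Lemma Aomega_brE i j k :
  Aomega_br (vec F i) (vec F j) (vec F k) = br_basis i j k.
Proof. by rewrite /Aomega_br !lextE. Qed.

Lemma brLLM_anti r s t : brLLM r s t = - brLLM s r t.
Proof. by rewrite /brLLM -scaleNr -mulrNz opprB (addrC r s). Qed.

Lemma brLMM_anti r s t : brLMM r s t = - brLMM r t s.
Proof. by rewrite /brLMM -scaleNr -mulrNz opprB (addrC s t). Qed.

Fact Aomega_br_alt : alternating Aomega_br.
Proof.
apply: malg_alternating => [i|i j]; apply: malg_lin_eq => k;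
  rewrite ?opp_homE ?zero_homE !Aomega_brE.
- by case: i k => i [] k //=; rewrite /brLLM /brLMM subrr scale0r.
- case: i j k => i [] j [] k //=; rewrite ?opprK ?oppr0 //.
  + exact: brLLM_anti.
  + exact: brLMM_anti.
Qed.

Lemma Aomega_ind (P : Aomega -> Prop) : (forall i, P (vec F i)) ->
  (forall a x y, P x -> P y -> P (a *: x + y)) -> forall x, P x.
Proof.
move=> Pv PD; apply: malg_span_ind => //.
by rewrite -(addNr (genL 0)) -scaleN1r; apply: PD; apply: Pv.
Qed.

Lemma Aomega_ind_LM (P : Aomega -> Prop) :
  (forall i, P (match i with inl r => genL r | inr r => genM r end)) ->
  (forall a x y, P x -> P y -> P (a *: x + y)) -> forall x, P x.
Proof. by move=> Pv; apply: Aomega_ind => i; move: (Pv i); case: i. Qed.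

Lemma Aomega_br_lin1 a x y u v :
  Aomega_br (a *: x + y) u v = a *: Aomega_br x u v + Aomega_br y u v.
Proof. by rewrite linearP. Qed.

Lemma Aomega_br_lin2 a x y u v :
  Aomega_br u (a *: x + y) v = a *: Aomega_br u x v + Aomega_br u y v.
Proof. by rewrite linearP. Qed.

Lemma Aomega_br_lin3 a x y u v :
  Aomega_br u v (a *: x + y) = a *: Aomega_br u v x + Aomega_br u v y.
Proof. by rewrite linearP. Qed.

Fact Aomega_br_alt23 x y : Aomega_br x y y = 0.
Proof.
elim/Aomega_ind: x y => [k|a x x' Hx Hx'] y; last first.
  by rewrite Aomega_br_lin1 Hx Hx' scaler0 addr0.
apply: (@malg_alternating _ _ _ (Aomega_br (vec F k))) => [i|i j];
  rewrite !Aomega_brE.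
- by case: k i => k [] i //=; rewrite /brLLM /brLMM subrr scale0r.
- case: k i j => k [] i [] j //=; rewrite ?opprK ?oppr0 //.
  + exact: brLMM_anti.
  + exact: brLLM_anti.
Qed.

Fact Aomega_br_jacobi x1 x2 x3 x4 x5 :
  Aomega_br x1 x2 (Aomega_br x3 x4 x5) =
    Aomega_br (Aomega_br x1 x2 x3) x4 x5 + Aomega_br x3 (Aomega_br x1 x2 x4) x5
    + Aomega_br x3 x4 (Aomega_br x1 x2 x5).
Proof.
apply: (@jacobi_free F Aomega (fun r => genL r) (fun r => genM r)
  (fun x y z => Aomega_br x y z)); first exact: Aomega_ind_LM.
all: move=> *; rewrite ?Aomega_br_lin1 ?Aomega_br_lin2 ?Aomega_br_lin3 ?Aomega_brE //.
Qed.

HB.instance Definition _ := Lmodule_isThreeLie.Build F Aomega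
  Aomega_br_alt Aomega_br_alt23 Aomega_br_jacobi.

Lemma br3_LLM r s t :
  br3 (genL r) (genL s) (genM t) = (s - r)%:~R *: genL (r + s - t).
Proof. exact: Aomega_brE. Qed.

Lemma br3_LMM r s t :
  br3 (genL r) (genM s) (genM t) = (t - s)%:~R *: genM (s + t - r).
Proof. exact: Aomega_brE. Qed.

Lemma br3_LLL r s t : br3 (genL r) (genL s) (genL t) = 0.
Proof. exact: Aomega_brE. Qed.

Lemma br3_MMM r s t : br3 (genM r) (genM s) (genM t) = 0.
Proof. exact: Aomega_brE. Qed.

Definition adp (r : int) : inner Aomega :=
  if r == 0 then ad (genL 0) (genM 0)
  else 2%:R^-1 *: (ad (genL 0) (genM (- r)) + ad (genL r) (genM 0)).

Definition adq (r : int) : inner Aomega :=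
  if r == 0 then ad (genL 0) (genM 0) - ad (genL 1) (genM 1)
  else r%:~R^-1 *: (ad (genL 0) (genM (- r)) - ad (genL r) (genM 0)).

Definition adx (r : int) : inner Aomega :=
  if r == 0 then 2%:R^-1 *: ad (genL 1) (genL (- 1))
  else r%:~R^-1 *: ad (genL r) (genL 0).

Definition adz (r : int) : inner Aomega :=
  if r == 0 then 2%:R^-1 *: ad (genM 1) (genM (- 1))
  else (- r)%:~R^-1 *: ad (genM (- r)) (genM 0).

End Aomega.

Section IntermediateSeries.
Context (F : fieldType) (lambda mu : F).

Definition V := {malg F[F]}.
HB.instance Definition _ := GRing.Lmodule.on V.

Definition genv (alpha : F) : V := vec F alpha.

(* Every rho(L_r, M_s) only depends on k = s - r. *)
Definition shift_op (k : int) : gl V :=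
  lext (fun alpha => (lambda + alpha + k%:~R * mu) *: genv (alpha + k%:~R)).

Definition rho_basis (i j : int + int) : gl V :=
  match i, j with
  | inl r, inr s => shift_op (s - r)
  | inr s, inl r => - shift_op (s - r)
  | inl _, inl _ | inr _, inr _ => 0
  end.

Definition rho : {linear Aomega F -> {linear Aomega F -> gl V}} :=
  lext (fun i => lext (rho_basis i)).

Lemma rhoLM r s alpha :
  rho (genL F r) (genM F s) (genv alpha) =
    (lambda + alpha + (s - r)%:~R * mu) *: genv (alpha + (s - r)%:~R).
Proof. by rewrite /rho !lextE. Qed.

Lemma rhoLL r s : rho (genL F r) (genL F s) = 0.
Proof. by rewrite /rho !lextE. Qed.

Lemma rhoMM r s : rho (genM F r) (genM F s) = 0.
Proof. by rewrite /rho !lextE. Qed.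

Lemma rho_alternating : alternating rho.
Proof.
apply: malg_alternating => [i|i j]; rewrite /rho !lextE.
- by case: i.
- by case: i j => i [] j /=; rewrite ?opprK ?oppr0.
Qed.

(* The p_r, q_r, x_r, z_r form a basis of ad(A), so these values determine the
   linear map psi; psi_exists below shows that such a map exists. *)
Definition is_psi (psi : {linear inner (Aomega F) -> gl V}) : Prop :=
  forall (r : int) (alpha : F),
    [/\ psi (adp F r) (genv alpha) =
          (lambda + alpha - r%:~R * mu) *: genv (alpha - r%:~R),
        psi (adq F r) (genv alpha) = 0,
        psi (adx F r) (genv alpha) = 0
      & psi (adz F r) (genv alpha) = 0].

Section Existence.
Context (charF0 : [pchar F] =i pred0).

Lemma is_psi_ad (psi : {linear inner (Aomega F) -> gl V}) :
  (forall r s alpha, psi (ad (genL F r) (genM F s)) (genv alpha) =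
    (lambda + alpha - (r - s)%:~R * mu) *: genv (alpha - (r - s)%:~R)) ->
  (forall r s alpha, psi (ad (genL F r) (genL F s)) (genv alpha) = 0) ->
  (forall r s alpha, psi (ad (genM F r) (genM F s)) (genv alpha) = 0) ->
  is_psi psi.
Proof.
move=> psiLM psiLL psiMM r alpha.
have two0 : (2%:R : F) != 0.
  by rewrite ((pcharf0P F).1 charF0).
have int0 (n : int) : n != 0 -> n%:~R != 0 :> F.
  have nat0 k : k.+1%:R != 0 :> F by rewrite ((pcharf0P F).1 charF0).
  by case: n => [[|k]|k] // _; rewrite ?NegzE ?mulrNz ?oppr_eq0 nat0.
have [P PE] : exists P, P = psi^~ (genv alpha) by eexists.
have PZ c f : P (c *: f) = c *: P f by rewrite PE (linearZ_LR psi).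
have PD f g : P (f + g) = P f + P g by rewrite PE (linearD psi).
have PB f g : P (f - g) = P f - P g by rewrite PE (linearB psi).
have PLM r' s : P (ad (genL F r') (genM F s)) =
    (lambda + alpha - (r' - s)%:~R * mu) *: genv (alpha - (r' - s)%:~R).
  by rewrite PE psiLM.
have PLL r' s : P (ad (genL F r') (genL F s)) = 0 by rewrite PE psiLL.
have PMM r' s : P (ad (genM F r') (genM F s)) = 0 by rewrite PE psiMM.
have EP f : psi f (genv alpha) = P f by rewrite PE.
rewrite !EP; clear psiLM psiLL psiMM EP PE.
rewrite /adp /adq /adx /adz; case: (eqVneq r 0) => [->|r0]; split.
- by rewrite PLM subrr.
- by rewrite PB !PLM !subrr.
- by rewrite PZ PLL scaler0.
- by rewrite PZ PMM scaler0.
- rewrite PZ PD !PLM !subr0 sub0r opprK -mulr2n -scaler_nat scalerA.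
  by rewrite mulVf // scale1r.
- by rewrite PZ PB !PLM !subr0 sub0r opprK subrr scaler0.
- by rewrite PZ PLL scaler0.
- by rewrite PZ PMM scaler0.
Qed.

Let psiT (k : int) (alpha : F) : {linear Aomega F -> V} :=
  lext (fun i => match i with
    | inl r => (lambda + alpha - (r - k)%:~R * mu) *: genv (alpha - (r - k)%:~R)
    | inr _ => 0 end).

Let psi_fun (f : inner (Aomega F)) : gl V := lext (fun alpha =>
  psiT 0 alpha (inner_val f (genL F 0)) - psiT 1 alpha (inner_val f (genL F 1))).

Let psiE f alpha : psi_fun f (genv alpha) =
  psiT 0 alpha (inner_val f (genL F 0)) - psiT 1 alpha (inner_val f (genL F 1)).
Proof. exact: lextE. Qed.

Let psi_linear : linear psi_fun.
Proof.
move=> a f g; apply: malg_lin_eq => alpha.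
have H (h : {linear Aomega F -> V}) x :
    h (inner_val (a *: f + g) x) = a *: h (inner_val f x) + h (inner_val g x).
  by rewrite -(linearP h) -scale_homE -add_homE.
rewrite (add_homE (a *: psi_fun f)) (scale_homE a (psi_fun f)).
rewrite [LHS]psiE [psi_fun f _]psiE [psi_fun g _]psiE.
by rewrite !H opprD scalerBr addrACA.
Qed.

HB.instance Definition _ :=
  GRing.isLinear.Build F (inner (Aomega F)) (gl V) _ psi_fun psi_linear.

Lemma psi_exists : exists psi, is_psi psi.
Proof.
have T0 k a r : psiT k a (genL F r) =
    (lambda + a - (r - k)%:~R * mu) *: genv (a - (r - k)%:~R) by rewrite lextE.
have TZ k a c y : psiT k a (c *: y) = c *: psiT k a y by rewrite linearZ_LR.
have TO k a : psiT k a 0 = 0 by rewrite linear0.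
have T1 k a r : psiT k a (genM F r) = 0 by rewrite lextE.
pose psi : {linear inner (Aomega F) -> gl V} := psi_fun.
have psiLM r s a : psi (ad (genL F r) (genM F s)) (genv a) =
    (lambda + a - (r - s)%:~R * mu) *: genv (a - (r - s)%:~R).
  rewrite psiE /=.
  have E n : br3 (genL F r) (genM F s) (genL F n) =
      (r - n)%:~R *: genL F (r + n - s).
    by rewrite [LHS]Aomega_brE /= /brLLM -scaleNr -mulrNz opprB.
  rewrite !E !TZ !T0.
  rewrite (_ : r + 1 - s - 1 = r - s); last by ring.
  rewrite (_ : r + 0 - s - 0 = r - s); last by ring.
  by rewrite !scalerA -scalerBl; congr (_ *: _); ring.
have psiLL r s a : psi (ad (genL F r) (genL F s)) (genv a) = 0.
  by rewrite psiE /= !br3_LLL !TO subrr.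
have psiMM r s a : psi (ad (genM F r) (genM F s)) (genv a) = 0.
  rewrite psiE /=.
  have E n : br3 (genM F r) (genM F s) (genL F n) =
      (s - r)%:~R *: genM F (r + s - n) by exact: Aomega_brE.
  by rewrite !E !TZ !T1 !scaler0 subrr.
exists psi; exact (is_psi_ad psiLM psiLL psiMM).
Qed.

End Existence.

End IntermediateSeries.

(* Main.v *)
Require Import Defs.
From mathcomp Require Import all_boot all_order all_algebra.
From mathcomp Require Import boolp ring.
From mathcomp.multinomials Require Import monalg.

(** Write [T k] for the operator [v_a |-> (lambda + a + k mu) v_(a+k)], so that
    [rho (L_r, M_s) = T (s - r)] and [rho] vanishes on the pairs [(L_r, L_s)]
    and [(M_r, M_s)]. Four things have to be seen.

    1. [rho] is a module. Both axioms are quadrilinear, hence may be checked on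
    the generators, where they reduce to
    [T k (T l v) - T m (T n v) = (l - n) T (k + l) v] for [k + l = m + n].
    With [x = lambda + a] and [N = k + l], the coefficient of [T k (T l v_a)] is
    [(x + l mu) (x + l + k mu)
       = x^2 + N mu x + l x + N l mu^2 + l^2 mu (1 - mu)];
    it is affine in [l] for fixed [N] exactly when [mu (1 - mu) = 0], which is
    where [mu = 0] or [mu = 1] enters, and its slope is then [x + N mu], the
    coefficient of [T N v_a]. See [free_rep_comm], [free_rep_br] and
    [rho_threeLie_module].

    2. The center of the span of the [T k] is zero. A central [f] commutes with
    [T 0], which is diagonal with distinct eigenvalues [lambda + a]; so [f] is
    diagonal, and being in the span it is [c T 0]. Commuting with [T 1] at a
    vector that [T 1] does not kill then forces [c = 0]. See [Lrho_center].

    3. The values of [psi] on the [p, q, x, z] are turned into values on the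
    inner derivations [ad (x, y)] by the expansions
    [ad (L_r, M_s) = p_(r-s) - (r + s)/2 q_(r-s)],
    [ad (L_r, L_s) = (r - s) x_(r+s)] and [ad (M_r, M_s) = (r - s) z_(-r-s)];
    they give [psi (ad (x, y)) = rho (x, y)]. See [is_psi_rho].

    4. A linear map on [ad(B)] that takes [ad (x, y)] to [rho (x, y)] is a Lie
    morphism, because the brackets [[ad (x, y), ad (z, t)]] and
    [[rho (x, y), rho (z, t)]] are given by the same formula. See
    [induced_inner_module]. *)

Set Implicit Arguments.
Unset Strict Implicit.
Unset Printing Implicit Defensive.

Import GRing.Theory.
Local Open Scope ring_scope.

(** * Multilinear maps *)

Section Multilinear.
Context (F : fieldType).
Implicit Types X Y Z W A : lmodType F.

Definition trilinear X Y Z W (f : X -> Y -> Z -> W) : Prop :=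
  [/\ forall u v, linear (fun x => f x u v),
      forall u v, linear (fun x => f u x v)
    & forall u v, linear (fun x => f u v x)].

Definition quadrilinear A W (f : A -> A -> A -> A -> W) : Prop :=
  [/\ forall u v w, linear (fun x => f x u v w),
      forall u v w, linear (fun x => f u x v w),
      forall u v w, linear (fun x => f u v x w)
    & forall u v w, linear (fun x => f u v w x)].

Lemma trilinear_hom X Y Z W (b : {linear X -> {linear Y -> {linear Z -> W}}}) :
  trilinear (fun x y z => b x y z).
Proof. by split=> u v a x y; rewrite linearP. Qed.

Lemma trilinear0 X Y Z W (f : X -> Y -> Z -> W) : trilinear f ->
  [/\ forall u v, f 0 u v = 0, forall u v, f u 0 v = 0
    & forall u v, f u v 0 = 0].
Proof.
move=> [f1 f2 f3]; split=> u v.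
- by have := f1 u v (-1) 0 0; rewrite scaler0 addr0 scaleN1r addNr.
- by have := f2 u v (-1) 0 0; rewrite scaler0 addr0 scaleN1r addNr.
- by have := f3 u v (-1) 0 0; rewrite scaler0 addr0 scaleN1r addNr.
Qed.

Lemma trilinearZ X Y Z W (f : X -> Y -> Z -> W) : trilinear f ->
  [/\ forall a x u v, f (a *: x) u v = a *: f x u v,
      forall a x u v, f u (a *: x) v = a *: f u x v
    & forall a x u v, f u v (a *: x) = a *: f u v x].
Proof.
move=> fl; have [f01 f02 f03] := trilinear0 fl; case: fl => f1 f2 f3.
split=> a x u v.
- by have := f1 u v a x 0; rewrite f01 !addr0.
- by have := f2 u v a x 0; rewrite f02 !addr0.
- by have := f3 u v a x 0; rewrite f03 !addr0.
Qed.

Lemma quadrilinearD A W (f g : A -> A -> A -> A -> W) :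
  quadrilinear f -> quadrilinear g ->
  quadrilinear (fun x y z t => f x y z t + g x y z t).
Proof.
move=> [f1 f2 f3 f4] [g1 g2 g3 g4].
split=> u v w a x y.
- by rewrite f1 g1 scalerDr addrACA.
- by rewrite f2 g2 scalerDr addrACA.
- by rewrite f3 g3 scalerDr addrACA.
- by rewrite f4 g4 scalerDr addrACA.
Qed.

Lemma quadrilinear_perm2 A W (f : A -> A -> A -> A -> W) :
  quadrilinear f -> quadrilinear (fun x y z t => f z t x y).
Proof. by move=> [f1 f2 f3 f4]; split. Qed.

Lemma quadrilinear_rot3 A W (f : A -> A -> A -> A -> W) :
  quadrilinear f -> quadrilinear (fun x y z t => f y z x t).
Proof. by move=> [f1 f2 f3 f4]; split. Qed.

Lemma quadrilinear_rot3V A W (f : A -> A -> A -> A -> W) :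
  quadrilinear f -> quadrilinear (fun x y z t => f z x y t).
Proof. by move=> [f1 f2 f3 f4]; split. Qed.

(** That the [e i] span [A] is expressed as an induction principle, the form in
    which it serves to extend an identity one argument at a time. *)
Lemma quadrilinear_ext I A W (e : I -> A) (f g : A -> A -> A -> A -> W) :
  (forall P : A -> Prop, (forall i, P (e i)) ->
     (forall a x y, P x -> P y -> P (a *: x + y)) -> forall x, P x) ->
  quadrilinear f -> quadrilinear g ->
  (forall i j k l, f (e i) (e j) (e k) (e l) = g (e i) (e j) (e k) (e l)) ->
  forall x y z t, f x y z t = g x y z t.
Proof.
move=> e_ind [f1 f2 f3 f4] [g1 g2 g3 g4] fg.
elim/e_ind=> [i|a x x' Hx Hx'] y z t; last by rewrite f1 g1 Hx Hx'.
elim/e_ind: y z t => [j|a x x' Hx Hx'] z t; last by rewrite f2 g2 Hx Hx'.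
elim/e_ind: z t => [k|a x x' Hx Hx'] t; last by rewrite f3 g3 Hx Hx'.
elim/e_ind: t => [l|a x x' Hx Hx']; last by rewrite f4 g4 Hx Hx'.
exact: fg.
Qed.

End Multilinear.

(** * The module axioms on generators *)

(** The vector spaces, the bracket [t] and the action [R] are abstract here:
    only multilinearity and the values on generators matter. *)
Section FreeRepresentation.
Context (F : fieldType) (A V : lmodType F) (lambda mu : F).
Context (L M : int -> A) (v : F -> V) (t : A -> A -> A -> A) (R : A -> A -> V -> V).
Let e (i : int + int) := match i with inl r => L r | inr r => M r end.

Context (A_ind : forall P : A -> Prop, (forall i, P (e i)) ->
  (forall a x y, P x -> P y -> P (a *: x + y)) -> forall x, P x).
Context (t_lin : trilinear t) (R_lin : trilinear R).
Context (tLLL : forall r s q, t (L r) (L s) (L q) = 0).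
Context (tLLM : forall r s q,
  t (L r) (L s) (M q) = (s - r)%:~R *: L (r + s - q)).
Context (tLML : forall r s q,
  t (L r) (M q) (L s) = - ((s - r)%:~R *: L (r + s - q))).
Context (tMLL : forall r s q,
  t (M q) (L r) (L s) = (s - r)%:~R *: L (r + s - q)).
Context (tLMM : forall r s q,
  t (L r) (M s) (M q) = (q - s)%:~R *: M (s + q - r)).
Context (tMLM : forall r s q,
  t (M s) (L r) (M q) = - ((q - s)%:~R *: M (s + q - r))).
Context (tMML : forall r s q,
  t (M s) (M q) (L r) = (q - s)%:~R *: M (s + q - r)).
Context (tMMM : forall r s q, t (M r) (M s) (M q) = 0).
Context (RLL : forall r s a, R (L r) (L s) (v a) = 0).
Context (RMM : forall r s a, R (M r) (M s) (v a) = 0).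
Context (RLM : forall r s a, R (L r) (M s) (v a) =
  (lambda + a + (s - r)%:~R * mu) *: v (a + (s - r)%:~R)).
Context (RML : forall r s a, R (M s) (L r) (v a) =
  - ((lambda + a + (s - r)%:~R * mu) *: v (a + (s - r)%:~R))).
Context (mu01 : mu = 0 \/ mu = 1).

Let comb3 n0 n1 n2 n3 (a0 a1 a2 a3 : F) :
  n0 = n1 -> n0 = n2 -> n0 = n3 -> a0 = a1 + a2 + a3 ->
  a0 *: v n0 = a1 *: v n1 + a2 *: v n2 + a3 *: v n3.
Proof. by move=> <- <- <- ->; rewrite !scalerDl. Qed.

Let comb2 n0 n1 n2 (a0 a1 a2 : F) :
  n0 = n1 -> n0 = n2 -> a0 = a1 + a2 ->
  a0 *: v n0 = a1 *: v n1 + a2 *: v n2.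
Proof. by move=> <- <- ->; rewrite !scalerDl. Qed.

Let comb0 n1 n2 (a1 a2 : F) :
  n1 = n2 -> a1 + a2 = 0 -> 0 = a1 *: v n1 + a2 *: v n2.
Proof. by move=> <- a0; rewrite -!scalerDl a0 scale0r. Qed.

Let R_br_quad w : quadrilinear (fun x1 x2 x3 x4 => R (t x1 x2 x3) x4 w).
Proof.
case: t_lin R_lin => t1 t2 t3 [R1 R2 R3].
by split=> x y z a u u'; rewrite ?t1 ?t2 ?t3 ?R1 ?R2.
Qed.

Let R_br_quad' w : quadrilinear (fun x1 x2 x3 x4 => R x3 (t x1 x2 x4) w).
Proof.
case: t_lin R_lin => t1 t2 t3 [R1 R2 R3].
by split=> x y z a u u'; rewrite ?t1 ?t2 ?t3 ?R1 ?R2.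
Qed.

Let R_R_quad w : quadrilinear (fun x1 x2 x3 x4 => R x1 x2 (R x3 x4 w)).
Proof.
case: R_lin => R1 R2 R3.
by split=> x y z a u u'; rewrite ?R1 ?R2 ?R3.
Qed.

(** When both pairs consist of an [L] and an [M], this is the Witt relation
    [[T k, T l] = (l - k) T (k + l)], with the second product of the commutator
    moved to the right. *)
Lemma free_rep_comm x1 x2 x3 x4 a : R x1 x2 (R x3 x4 (v a)) =
  R x3 x4 (R x1 x2 (v a)) + R (t x1 x2 x3) x4 (v a) + R x3 (t x1 x2 x4) (v a).
Proof.
have [t01 t02 t03] := trilinear0 t_lin; have [R01 R02 R03] := trilinear0 R_lin.
have [tZ1 tZ2 tZ3] := trilinearZ t_lin; have [RZ1 RZ2 RZ3] := trilinearZ R_lin.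
have E := (t01, t02, t03, R01, R02, R03, tZ1, tZ2, tZ3, RZ1, RZ2, RZ3).
have E' := (tLLL, tLLM, tLML, tMLL, tLMM, tMLM, tMML, tMMM, RLL, RMM, RLM, RML).
move: x1 x2 x3 x4; apply: (quadrilinear_ext A_ind) => //.
  apply: quadrilinearD => //; apply: quadrilinearD => //.
  exact: quadrilinear_perm2 (R_R_quad _).
(* Each of the sixteen cases compares multiples of one and the same [v b]; the
   coefficients agree as polynomials once [mu] is 0 or 1. *)
case=> i1 [] i2 [] i3 [] i4; rewrite /e !E'; try reflexivity.
all: rewrite -?scaleNr ?E ?E' -?scaleNr ?E ?E' -?scaleNr ?scaler0 ?addr0 ?add0r ?scalerA.
all: try reflexivity.
all: (first [apply: comb3 | apply: comb2 | apply: comb0]); try ring.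
all: by case: mu01 => ->; ring.
Qed.

(** On generators at most two of the three products survive; where any does, the
    identity is, up to sign, [T k (T l v) - T m (T n v) = (l - n) T (k + l) v]
    with [k + l = m + n]. *)
Lemma free_rep_br x1 x2 x3 x4 a : R (t x1 x2 x3) x4 (v a) =
  R x1 x2 (R x3 x4 (v a)) + R x2 x3 (R x1 x4 (v a)) + R x3 x1 (R x2 x4 (v a)).
Proof.
have [t01 t02 t03] := trilinear0 t_lin; have [R01 R02 R03] := trilinear0 R_lin.
have [tZ1 tZ2 tZ3] := trilinearZ t_lin; have [RZ1 RZ2 RZ3] := trilinearZ R_lin.
have E := (t01, t02, t03, R01, R02, R03, tZ1, tZ2, tZ3, RZ1, RZ2, RZ3).
have E' := (tLLL, tLLM, tLML, tMLL, tLMM, tMLM, tMML, tMMM, RLL, RMM, RLM, RML).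
move: x1 x2 x3 x4; apply: (quadrilinear_ext A_ind) => //.
  apply: quadrilinearD; first apply: quadrilinearD => //.
    exact: quadrilinear_rot3 (R_R_quad _).
  exact: quadrilinear_rot3V (R_R_quad _).
case=> i1 [] i2 [] i3 [] i4; rewrite /e !E'; try reflexivity.
all: rewrite -?scaleNr ?E ?E' -?scaleNr ?E ?E' -?scaleNr ?scaler0 ?addr0 ?add0r ?scalerA.
all: try reflexivity.
all: (first [apply: comb3 | apply: comb2 | apply: comb0]); try ring.
all: by case: mu01 => ->; ring.
Qed.

End FreeRepresentation.

(** * Inner derivations and induced modules *)

Lemma alternatingN (F : fieldType) (U W : lmodType F)
  (b : {linear U -> {linear U -> W}}) x y : alternating b -> b y x = - b x y.
Proof.
move=> b0; apply/eqP; rewrite -addr_eq0; have := b0 (x + y).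
rewrite (linearD b) add_homE [b x (x + y)]linearD [b y (x + y)]linearD.
by rewrite !b0 add0r addr0 addrC => ->.
Qed.

Section InnerAlgebra.
Context (F : fieldType) (B : threeLieType F).

Lemma inner_eq (f g : inner B) : (forall x, inner_val f x = inner_val g x) -> f = g.
Proof. by move=> fg; apply: val_inj; apply: hom_ext. Qed.

Lemma inner_linE a (f g : inner B) x :
  inner_val (a *: f + g) x = a *: inner_val f x + inner_val g x.
Proof. by []. Qed.

Lemma ad_linl a (x y z : B) : ad (a *: x + y) z = a *: ad x z + ad y z.
Proof.
by apply: inner_eq => u; rewrite inner_linE /= linearP.
Qed.

Lemma ad_linr a (x y z : B) : ad z (a *: x + y) = a *: ad z x + ad z y.
Proof.
by apply: inner_eq => u; rewrite inner_linE /= linearP.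
Qed.

Lemma inner_ind (P : inner B -> Prop) : P 0 ->
  (forall a x y f, P f -> P (a *: ad x y + f)) -> forall f, P f.
Proof.
move=> P0 PD [f pf]; have [s fs] := asboolW pf.
suff -> : Inner pf = \sum_(t <- s) t.1 *: ad t.2.1 t.2.2.
  by elim/big_rec: _ => // t g _; apply: PD.
apply: val_inj; rewrite /= fs; elim: s {fs} => [|t s IHs]; first by rewrite !big_nil.
by rewrite !big_cons IHs.
Qed.

Lemma ad_anti (x y : B) : ad y x = - ad x y.
Proof. by apply: val_inj; rewrite /= (alternatingN _ _ br3_alt). Qed.

Lemma inner_commE (f g : inner B) x :
  inner_val (inner_comm f g) x = inner_val f (inner_val g x) - inner_val g (inner_val f x).
Proof. by []. Qed.

Lemma inner_comm_linl a (f g h : inner B) :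
  inner_comm (a *: f + g) h = a *: inner_comm f h + inner_comm g h.
Proof.
apply: inner_eq => x.
by rewrite inner_linE !inner_commE !inner_linE linearP opprD addrACA scalerBr.
Qed.

Lemma inner_comm_linr a (f g h : inner B) :
  inner_comm h (a *: f + g) = a *: inner_comm h f + inner_comm h g.
Proof.
apply: inner_eq => x.
by rewrite inner_linE !inner_commE !inner_linE linearP opprD addrACA scalerBr.
Qed.

Lemma inner_comm_ad (x y z t : B) :
  inner_comm (ad x y) (ad z t) = ad (br3 x y z) t + ad z (br3 x y t).
Proof. by apply: val_inj; exact: gl_comm_ad. Qed.

Lemma gl_comm_linl (W : lmodType F) a (f g h : gl W) :
  gl_comm (a *: f + g) h = a *: gl_comm f h + gl_comm g h.
Proof.
apply: hom_ext => x; rewrite gl_commE.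
change (a *: f (h x) + g (h x) - h (a *: f x + g x)
  = a *: (f (h x) - h (f x)) + (g (h x) - h (g x))).
by rewrite linearP opprD addrACA scalerBr.
Qed.

Lemma gl_comm_linr (W : lmodType F) a (f g h : gl W) :
  gl_comm h (a *: f + g) = a *: gl_comm h f + gl_comm h g.
Proof.
by rewrite gl_commN gl_comm_linl opprD -scalerN -!gl_commN.
Qed.

Lemma inner_lin_ext (W : lmodType F) (h k : inner B -> W) :
  linear h -> linear k -> (forall x y, h (ad x y) = k (ad x y)) -> h =1 k.
Proof.
have lin0 (l : inner B -> W) : linear l -> l 0 = 0.
  by move=> ll; have := ll (-1) 0 0; rewrite scaler0 addr0 scaleN1r addNr.
move=> hl kl hk; elim/inner_ind=> [|a x y f IHf]; first by rewrite !lin0.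
by rewrite hl kl hk IHf.
Qed.

(** On two generators of [ad(B)] both sides expand by the same derivation rule:
    the fundamental identity for [ad] and the first module axiom for [rho]. *)
Lemma induced_inner_module (W : lmodType F)
    (rho : {linear B -> {linear B -> gl W}}) (psi : {linear inner B -> gl W}) :
  is_threeLie_module rho -> (forall x y, psi (ad x y) = rho x y) ->
  is_inner_module psi.
Proof.
move=> [_ rhoC _] psiE f g.
have psiP a u w : psi (a *: u + w) = a *: psi u + psi w by rewrite linearP.
move: f; apply: inner_lin_ext => [a u w|a u w|x y].
- by rewrite inner_comm_linl psiP.
- by rewrite psiP gl_comm_linl.
move: g; apply: inner_lin_ext => [a u w|a u w|z t].
- by rewrite inner_comm_linr psiP.
- by rewrite psiP gl_comm_linr.
(* The factor 1 brings the sum into the shape [a *: u + w] of [psiP]. *)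
rewrite inner_comm_ad -[ad (br3 x y z) t]scale1r psiP scale1r !psiE.
by rewrite rhoC.
Qed.

End InnerAlgebra.

(** * The module of the intermediate series *)

Section IntermediateSeriesModule.
Context (F : fieldType) (lambda mu : F).
Local Notation A := (Aomega F).
Local Notation rho := (rho lambda mu).

Lemma rhoML r s alpha : rho (genM F s) (genL F r) (genv alpha) =
  - ((lambda + alpha + (s - r)%:~R * mu) *: genv (alpha + (s - r)%:~R)).
Proof.
have -> : rho (genM F s) (genL F r) = - shift_op lambda mu (s - r).
  by rewrite /Defs.rho !lextE.
by rewrite opp_homE; congr (- _); apply: lextE.
Qed.

Lemma rho_threeLie_module : mu = 0 \/ mu = 1 ->
  is_threeLie_module rho.
Proof.
move=> mu01.
have t_lin := trilinear_hom (@br3 F A).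
have R_lin := trilinear_hom rho.
have mv (Z : zmodType) (a b c d : Z) : a = b + c + d -> a - b = c + d.
  by move=> ->; apply/eqP; rewrite subr_eq [_ + b]addrC addrA.
have RLL r s a : rho (genL F r) (genL F s) (genv a) = 0 by rewrite rhoLL.
have RMM r s a : rho (genM F r) (genM F s) (genv a) = 0 by rewrite rhoMM.
split; first exact: rho_alternating.
- move=> x1 x2 x3 x4; apply: malg_lin_eq => a; rewrite gl_commE add_homE.
  apply: mv.
  apply: (free_rep_comm (lambda := lambda) (mu := mu)
    (@Aomega_ind_LM F) t_lin R_lin) => //;
    [move=> *; exact: Aomega_brE..| exact: rhoLM | exact: rhoML].
- move=> x1 x2 x3 x4; apply: malg_lin_eq => a; rewrite !add_homE.
  apply: (free_rep_br (lambda := lambda) (mu := mu)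
    (@Aomega_ind_LM F) t_lin R_lin) => //;
    [move=> *; exact: Aomega_brE..| exact: rhoLM | exact: rhoML].
Qed.

(** [T k] has a nonzero diagonal only if [k] vanishes in [F], and the diagonal is
    then that of [T 0], with entries [lambda + a]. *)
Lemma Lrho_diag f : Lrho rho f ->
  exists c, forall a, (f (genv a))@_a = c * (lambda + a).
Proof.
pose P (f : gl (V F)) := exists c, forall a, (f (genv a))@_a = c * (lambda + a).
have P0 : P 0 by exists 0 => a; rewrite zero_homE mcoeff0 mul0r.
have PD b g h : P g -> P h -> P (b *: g + h).
  move=> [c cP] [d dP]; exists (b * c + d) => a.
  by rewrite add_homE scale_homE mcoeffD mcoeffZ cP dP mulrDl mulrA.
have PN g : P g -> P (- g) by move=> /(PD (-1) _ 0)/(_ P0); rewrite addr0 scaleN1r.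
have PLM r s : P (rho (genL F r) (genM F s)).
  exists (((s - r)%:~R == 0 :> F)%:R) => a.
  rewrite rhoLM mcoeffZ mcoeffU -[X in _ == X]addr0 (inj_eq (addrI a)).
  by case: eqP => [->|_]; rewrite ?mul0r ?addr0 ?mulr1 ?mul1r ?mulr0.
have Prho x y : P (rho x y).
  elim/Aomega_ind_LM: x y => [i|b x x' Hx Hx'] y; last first.
    rewrite linearP; exact: PD.
  elim/Aomega_ind_LM: y => [j|b y y' Hy Hy']; last first.
    rewrite linearP; exact: PD.
  case: i j => r [] s.
  - by rewrite rhoLL.
  - exact: PLM.
  - by rewrite (alternatingN _ _ (rho_alternating _ _)); apply: PN; exact: PLM.
  - by rewrite rhoMM.
move=> [s ->]; elim: s => [|t s IHs]; first by rewrite big_nil.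
by rewrite big_cons; apply: PD.
Qed.

Lemma rho00_coef w b :
  (rho (genL F 0) (genM F 0) w)@_b = (lambda + b) * w@_b.
Proof.
elim/malg_span_ind: w => [|a|c x y Hx Hy].
- by rewrite linear0 mcoeff0 mulr0.
- rewrite rhoLM subrr mul0r !addr0 mcoeffZ mcoeffU.
  by case: eqP => [->|_]; rewrite ?mulr0.
- by rewrite linearP !mcoeffD !mcoeffZ Hx Hy mulrDr mulrCA.
Qed.

(** An element that commutes with [T 0] is diagonal since the eigenvalues
    [lambda + a] are distinct, hence equals [c T 0]; as
    [[c T 0, T 1] v_a = c (lambda + a + mu) v_(a+1)], commuting with [T 1] gives
    [c = 0]. *)
Lemma Lrho_center : center_trivial (Lrho rho).
Proof.
move=> f Lf fC; have [c cP] := Lrho_diag Lf.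
have fdiag a : f (genv a) = (c * (lambda + a)) *: genv a.
  apply/malgP => b; rewrite mcoeffZ mcoeffU.
  have [->|ab] := eqVneq a b; first by rewrite mulr1 cP.
  rewrite mulr0; apply/eqP.
  have L00 : Lrho rho (rho (genL F 0) (genM F 0)) by exact: span2_gen.
  have := congr1 (fun g : gl (V F) => (g (genv a))@_b) (fC _ L00).
  rewrite gl_commE zero_homE mcoeff0 mcoeffB rho00_coef rhoLM subrr mul0r !addr0.
  rewrite linearZ_LR mcoeffZ -mulrBl => /eqP; rewrite mulf_eq0 => /orP[|//].
  by rewrite opprD addrACA subrr add0r subr_eq0 (negPf ab).
have L01 : Lrho rho (rho (genL F 0) (genM F 1)) by exact: span2_gen.
(* Chosen so that [T 1] sends [v_a] to [v_(a+1)] with coefficient 1. *)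
pose a := 1 - lambda - mu.
have := congr1 (fun g : gl (V F) => (g (genv a))@_(a + 1)) (fC _ L01).
rewrite gl_commE zero_homE mcoeff0 fdiag linearZ_LR rhoLM subr0 mul1r.
rewrite linearZ_LR fdiag !scalerA -scalerBl mcoeffZ mcoeffUU mulr1 => c0.
have {}c0 : c = 0 by rewrite -[RHS]c0 /a; ring.
by apply: malg_lin_eq => b; rewrite fdiag c0 mul0r scale0r.
Qed.

End IntermediateSeriesModule.

(** * Expanding inner derivations in the p, q, x, z *)

(** Combinations of the members of a family [N] are compared through indices and
    coefficients alone, which leaves identities in [int] and in [F]. *)
Section Combine.
Context (F : fieldType) (W : lmodType F) (N : int -> W).

Lemma scale_eq n0 n1 (a0 a1 : F) :
  n1 = n0 -> a1 = a0 -> a1 *: N n1 = a0 *: N n0.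
Proof. by move=> -> ->. Qed.

Lemma scale_add2 n0 n1 n2 (c a0 a1 a2 : F) :
  n1 = n0 -> n2 = n0 -> c * (a1 + a2) = a0 ->
  c *: (a1 *: N n1 + a2 *: N n2) = a0 *: N n0.
Proof. by move=> -> -> <-; rewrite -scalerDl scalerA. Qed.

Lemma scale_sub2 n0 n1 n2 (c a0 a1 a2 : F) :
  n1 = n0 -> n2 = n0 -> c * (a1 - a2) = a0 ->
  c *: (a1 *: N n1 - a2 *: N n2) = a0 *: N n0.
Proof. by move=> -> -> <-; rewrite -scalerBl scalerA. Qed.

Lemma scale_comb2 n0 n1 n2 (c a0 a1 a2 : F) :
  n1 = n0 -> n2 = n0 -> c * a1 + a2 = a0 ->
  c *: (a1 *: N n1) + a2 *: N n2 = a0 *: N n0.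
Proof. by move=> -> -> <-; rewrite scalerA scalerDl. Qed.

End Combine.

Section InnerAomega.
Context (F : fieldType) (charF0 : [pchar F] =i pred0).
Local Notation A := (Aomega F).
Local Notation L := (genL F).
Local Notation M := (genM F).

Lemma inner_eqLM (f g : inner A) :
  (forall t, inner_val f (L t) = inner_val g (L t)) ->
  (forall t, inner_val f (M t) = inner_val g (M t)) -> f = g.
Proof.
move=> fgL fgM; apply: val_inj; apply: malg_lin_eq => i.
by case: i => t; [exact: fgL | exact: fgM].
Qed.

Lemma ad_LM_L r s t : inner_val (ad (L r) (M s)) (L t) = (r - t)%:~R *: L (r + t - s).
Proof.
have -> : inner_val (ad (L r) (M s)) (L t) = - brLLM F r t s by exact: Aomega_brE.
by rewrite /brLLM -scaleNr -mulrNz opprB.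
Qed.

Lemma ad_LM_M r s t : inner_val (ad (L r) (M s)) (M t) = (t - s)%:~R *: M (s + t - r).
Proof. exact: Aomega_brE. Qed.

Lemma ad_LL_L r s t : inner_val (ad (L r) (L s)) (L t) = 0.
Proof. exact: Aomega_brE. Qed.

Lemma ad_LL_M r s t : inner_val (ad (L r) (L s)) (M t) = (s - r)%:~R *: L (r + s - t).
Proof. exact: Aomega_brE. Qed.

Lemma ad_MM_L r s t : inner_val (ad (M r) (M s)) (L t) = (s - r)%:~R *: M (r + s - t).
Proof. exact: Aomega_brE. Qed.

Lemma ad_MM_M r s t : inner_val (ad (M r) (M s)) (M t) = 0.
Proof. exact: Aomega_brE. Qed.

Lemma inner_addE (f g : inner A) x : inner_val (f + g) x = inner_val f x + inner_val g x.
Proof. by []. Qed.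
Lemma inner_oppE (f : inner A) x : inner_val (- f) x = - inner_val f x.
Proof. by []. Qed.
Lemma inner_scaleE a (f : inner A) x : inner_val (a *: f) x = a *: inner_val f x.
Proof. by []. Qed.

Let innerE := (inner_addE, inner_oppE, inner_scaleE).

Let two0 : (2%:R : F) != 0.
Proof. by rewrite ((pcharf0P F).1 charF0). Qed.

Lemma intr_neq0 (n : int) : n != 0 -> n%:~R != 0 :> F.
Proof.
have nat0 k : k.+1%:R != 0 :> F by rewrite ((pcharf0P F).1 charF0).
by case: n => [[|k]|k] // _; rewrite ?NegzE ?mulrNz ?oppr_eq0 nat0.
Qed.

Lemma adp_L r t : inner_val (adp F r) (L t) = (r%:~R / 2%:R - t%:~R) *: L (r + t).
Proof.
rewrite /adp; case: eqVneq => [->|r0].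
  by rewrite ad_LM_L; apply: scale_eq; [ring | field].
by rewrite !innerE !ad_LM_L; apply: scale_add2; [ring | ring | field].
Qed.

Lemma adp_M r t : inner_val (adp F r) (M t) = (r%:~R / 2%:R + t%:~R) *: M (t - r).
Proof.
rewrite /adp; case: eqVneq => [->|r0].
  by rewrite ad_LM_M; apply: scale_eq; [ring | field].
by rewrite !innerE !ad_LM_M; apply: scale_add2; [ring | ring | field].
Qed.

Lemma adq_L r t : inner_val (adq F r) (L t) = (- 1) *: L (r + t).
Proof.
rewrite /adq; case: eqVneq => [->|/intr_neq0 r0]; rewrite !innerE !ad_LM_L.
  by rewrite -[LHS]scale1r; apply: scale_sub2; ring.
by apply: scale_sub2; [ring | ring | field].
Qed.

Lemma adq_M r t : inner_val (adq F r) (M t) = 1 *: M (t - r).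
Proof.
rewrite /adq; case: eqVneq => [->|/intr_neq0 r0]; rewrite !innerE !ad_LM_M.
  by rewrite -[LHS]scale1r; apply: scale_sub2; ring.
by apply: scale_sub2; [ring | ring | field].
Qed.

Lemma adx_L r t : inner_val (adx F r) (L t) = 0.
Proof. by rewrite /adx; case: eqP => _; rewrite innerE ad_LL_L scaler0. Qed.

Lemma adx_M r t : inner_val (adx F r) (M t) = (- 1) *: L (r - t).
Proof.
rewrite /adx; case: eqVneq => [->|/intr_neq0 r0]; rewrite innerE ad_LL_M scalerA;
  by apply: scale_eq; [ring | field].
Qed.

Lemma adz_L r t : inner_val (adz F r) (L t) = (- 1) *: M (- r - t).
Proof.
rewrite /adz; case: eqVneq => [->|/intr_neq0 r0]; rewrite innerE ad_MM_L scalerA.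
  by apply: scale_eq; [ring | field].
by apply: scale_eq; [ring | field; rewrite ?oppr_eq0].
Qed.

Lemma adz_M r t : inner_val (adz F r) (M t) = 0.
Proof. by rewrite /adz; case: eqP => _; rewrite innerE ad_MM_M scaler0. Qed.

(** With [k = r - s] fixed, [ad (L_r, M_s)] is affine in [r], with direction
    [- q_k]; the point [p_k] is reached at [r = k / 2], which is [r + s = 0]. *)
Lemma ad_LM_pq r s :
  ad (L r) (M s) = (- ((r + s)%:~R / 2%:R)) *: adq F (r - s) + adp F (r - s).
Proof.
apply: inner_eqLM => t; rewrite !innerE; apply/esym.
  by rewrite ad_LM_L adq_L adp_L; apply: scale_comb2; [ring | ring | field].
by rewrite ad_LM_M adq_M adp_M; apply: scale_comb2; [ring | ring | field].
Qed.

(** Up to the factor [s - r], [ad (L_r, L_s)] depends only on [r + s]; the same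
    holds for [ad (M_r, M_s)]. *)
Lemma ad_LL_x r s : ad (L r) (L s) = (r - s)%:~R *: adx F (r + s).
Proof.
apply: inner_eqLM => t; rewrite innerE; first by rewrite ad_LL_L adx_L scaler0.
by rewrite ad_LL_M adx_M scalerA; apply: scale_eq; ring.
Qed.

Lemma ad_MM_z r s : ad (M r) (M s) = (r - s)%:~R *: adz F (- (r + s)).
Proof.
apply: inner_eqLM => t; rewrite innerE; last by rewrite ad_MM_M adz_M scaler0.
by rewrite ad_MM_L adz_L scalerA; apply: scale_eq; ring.
Qed.

(** The expansions above express every [ad (x, y)] on generators through the
    elements on which [psi] is prescribed. *)
Lemma is_psi_rho (lambda mu : F) (psi : {linear inner A -> gl (V F)}) :
  is_psi lambda mu psi -> forall x y, psi (ad x y) = rho lambda mu x y.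
Proof.
move=> psiP x y.
have psiL a u w : psi (a *: u + w) = a *: psi u + psi w by rewrite linearP.
have psiZ a u : psi (a *: u) = a *: psi u by rewrite linearZ_LR.
have psiLM r s : psi (ad (L r) (M s)) = rho lambda mu (L r) (M s).
  apply: malg_lin_eq => a; rewrite ad_LM_pq psiL add_homE scale_homE.
  rewrite -/(genv a); have [-> -> _ _] := psiP (r - s) a.
  by rewrite scaler0 add0r rhoLM -(opprB r s) mulrNz mulNr.
elim/Aomega_ind_LM: x y => [i|b x x' Hx Hx'] y; last first.
  by rewrite ad_linl psiL Hx Hx' linearP.
elim/Aomega_ind_LM: y => [j|b y y' Hy Hy']; last first.
  by rewrite ad_linr psiL Hy Hy' linearP.
case: i j => r [] s.
- rewrite rhoLL ad_LL_x psiZ; apply: malg_lin_eq => a.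
  by rewrite scale_homE; have [_ _ -> _] := psiP (r + s) a; rewrite scaler0.
- exact: psiLM.
- by rewrite ad_anti (alternatingN _ _ (rho_alternating _ _)) linearN psiLM.
- rewrite rhoMM ad_MM_z psiZ; apply: malg_lin_eq => a.
  by rewrite scale_homE; have [_ _ _ ->] := psiP (- (r + s)) a; rewrite scaler0.
Qed.

End InnerAomega.

(** * The induced module *)

Theorem theorem3p6 (F : fieldType) (charF0 : [pchar F] =i pred0)
  (lambda mu : F) (mu01 : mu = 0 \/ mu = 1)
  (psi : {linear inner (Aomega F) -> gl (V F)}) (psiP : is_psi lambda mu psi) :
  is_induced_module (rho lambda mu) psi.
Proof.
have rho_mod := rho_threeLie_module lambda mu01.
have psiE := is_psi_rho charF0 psiP.
split; [exact: rho_mod | exact: Lrho_center | exact: psiE |].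
exact: induced_inner_module rho_mod psiE.
Qed.
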